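(* Let $(\Omega,\mathcal{F},\mathbb{P})$ be a probability space, let $\rho$ be a random variable on it with $\rho>0$ almost surely, $\mathbb{E}[\rho]<\infty$, and continuous CDF $F_\rho$ (i.e. $\rho$ has no atom), and set $\delta:=\mathbb{E}[\rho]$ and $\underline{\rho}:=\operatorname{essinf}\rho$. Let $m$ be a probability measure on $[0,1]$ and $x>0$. For a random variable $X$ define $$V(X):=\int_{[0,1]}F_X^{-1}(z)\,m(dz),$$ where $F_X^{-1}$ is the right-continuous quantile function of $X$, with $F_X^{-1}(0):=\lim_{z\downarrow0}F_X^{-1}(z)$ and $F_X^{-1}(1):=\lim_{z\uparrow1}F_X^{-1}(z)$. Consider the problem $$(P)\qquad \text{maximize } V(X)\ \text{ over random variables } X \text{ subject to } \mathbb{E}[\rho X]\le x,\ X\ge 0.$$ For $c\in(0,1)$ let $$\zeta(c):=\frac{m([c,1])}{\int_c^1F_\rho^{-1}(1-z)\,dz},\qquad \gamma^*:=\sup_{c\in(0,1)}\zeta(c).$$ Then the optimal value of $(P)$ is $\max(1/\delta,\gamma^* )\,x$. Furthermore: (i) If $\gamma^*=+\infty$, there exist $\beta_n\to\underline{\rho}$ such that $X_n:=k_n\mathbf{1}_{\{\rho\le\beta_n\}}$ with $k_n:=x/\mathbb{E}[\rho\mathbf{1}_{\{\rho\le\beta_n\}}]$ is feasible for $(P)$ and $V(X_n)\to+\infty$ as $n\to\infty$. (ii) If $\gamma^*\le 1/\delta$, then $X^*\equiv x/\delta$ is optimal for $(P)$. (iii) If $1/\delta<\gamma^*<+\infty$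 and the supremum defining $\gamma^*$ is attained at some $c^*\in(0,1)$, then $X^*:=k^*\mathbf{1}_{\{\rho\le\beta^*\}}$ with $\beta^*:=F_\rho^{-1}(1-c^* )$ and $k^*:=x/\mathbb{E}[\rho\mathbf{1}_{\{\rho\le\beta^*\}}]$ is optimal for $(P)$. (iv) If $1/\delta<\gamma^*<+\infty$ and the supremum defining $\gamma^*$ is not attained, then $(P)$ has no optimal solution. Furthermore, for any sequence $c_n\in(0,1)$ with $\zeta(c_n)\to\gamma^*$, setting $\beta_n:=F_\rho^{-1}(1-c_n)$, the payoffs $X_n:=k_n\mathbf{1}_{\{\rho\le\beta_n\}}$ with $k_n:=x/\mathbb{E}[\rho\mathbf{1}_{\{\rho\le\beta_n\}}]$ are feasible for $(P)$ and $V(X_n)$ converges to the optimal value as $n\to\infty$.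
   Context: $\rho$ is interpreted as the pricing kernel of a single-period complete market and $x$ as initial wealth. $F_\rho^{-1}$ denotes the right-continuous quantile function of $\rho$ (right-continuous inverse of its CDF). *)

(* Defs.v *)
From HB Require Import structures.
From mathcomp Require Import all_boot all_order all_algebra.
From mathcomp Require Import all_classical all_reals all_analysis.
From mathcomp Require Import ess_sup_inf.
Set Implicit Arguments. Unset Strict Implicit. Unset Printing Implicit Defensive.
Import Order.TTheory GRing.Theory Num.Theory.
Import numFieldNormedType.Exports.
Local Open Scope classical_set_scope.
Local Open Scope ring_scope.
Local Open Scope ereal_scope.

Section defs.
Context d {T : measurableType d} {R : realType} (P : probability T R).

Definition cdfF (X : T -> R) (t : R) : \bar R := P [set w | X w <= t]%R.

Definition quantile_open (X : T -> R) (z : R) : \bar R :=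
  ereal_inf [set t%:E | t in [set t : R | z%:E < cdfF X t]].

(* full quantile on [0,1]; the endpoint values are the one-sided limits,
   written as inf / sup since quantile_open is nondecreasing on (0,1). *)
Definition quantile (X : T -> R) (z : R) : \bar R :=
  if z == 0%R then ereal_inf [set quantile_open X u | u in `]0%R, 1%R[]
  else if z == 1%R then ereal_sup [set quantile_open X u | u in `]0%R, 1%R[]
  else quantile_open X z.

Definition Vfun (m : probability R R) (X : T -> R) : \bar R :=
  \int[m]_(z in `[0%R, 1%R]) quantile X z.

Definition feasible (rho : T -> R) (x : R) (X : T -> R) : Prop :=
  [/\ measurable_fun setT X,
      {ae P, forall w, (0 <= X w)%R} &
      \int[P]_w (rho w * X w)%:E <= x%:E].

Definition optimal (m : probability R R) (rho : T -> R) (x : R) (X : T -> R) : Prop :=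
  feasible rho x X /\ forall Y, feasible rho x Y -> Vfun m Y <= Vfun m X.

Definition opt_value (m : probability R R) (rho : T -> R) (x : R) : \bar R :=
  ereal_sup [set Vfun m X | X in feasible rho x].

Definition zeta (m : probability R R) (rho : T -> R) (c : R) : R :=
  (fine (m `[c, 1%R]%classic) /
   fine (\int[lebesgue_measure]_(z in `[c, 1%R]) quantile rho (1 - z)%R))%R.

Definition gamma_star (m : probability R R) (rho : T -> R) : \bar R :=
  ereal_sup [set (zeta m rho c)%:E | c in `]0%R, 1%R[].

Definition digital (rho : T -> R) (x beta : R) : T -> R :=
  let k := (x / fine (\int[P]_w (rho w * (\1_[set w | rho w <= beta]%R w))%:E))%R in
  fun w => (k * \1_[set w | rho w <= beta] w)%R.

End defs.

(* Main.v *)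
Require Import Defs.
From HB Require Import structures.
From mathcomp Require Import all_boot all_order all_algebra.
From mathcomp Require Import all_classical all_reals all_analysis.
From mathcomp Require Import ess_sup_inf measurable_realfun.
From mathcomp Require Import lra.
Set Implicit Arguments. Unset Strict Implicit. Unset Printing Implicit Defensive.
Import Order.TTheory GRing.Theory Num.Theory.
Import numFieldNormedType.Exports.
Local Open Scope classical_set_scope.
Local Open Scope ring_scope.
Local Open Scope ereal_scope.

(* Both the objective and the budget are decomposed over the level sets
   {X > t} (layer-cake formula). With c := P(X <= t), the level t contributes at
   most m[c, 1] to V(X), or at most 1 if c = 0, and it costs E[rho 1_{X > t}].
   Among events of probability 1 - c the cheapest is {rho <= F_rho^{-1}(1 - c)},
   whose cost is the denominator of zeta(c). So each level has a payoff/cost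
   ratio of at most max(1 / E[rho], sup zeta), which gives the upper bound,
   strictly below it on every level of positive probability when the supremum is
   not attained. Constants and digital payoffs realise each ratio exactly. *)

(** * Layer-cake formula with a density, by Tonelli's theorem *)

Section layer_cake.
Context {d : measure_display} {T : measurableType d} {R : realType}.
Variable mu : {sigma_finite_measure set T -> \bar R}.
Implicit Types f g : T -> \bar R.

(* Empty for [t < 0], so that level integrals can range over all of [R]. *)
Definition layer f (t : R) : set T := [set w | (0 <= t)%R /\ t%:E < f w].

(** Tonelli's theorem asks for joint measurability in [w] and [t]; measurability of each single
    layer then follows by taking sections. *)
Lemma measurable_layers f : measurable_fun [set: T] f ->
  measurable [set p : T * measurableTypeR R | layer f p.2 p.1].
Proof.
move=> mf; pose fsnd (p : T * measurableTypeR R) := (0 <= p.2)%R.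
rewrite (_ : [set _ | _] = fsnd @^-1` [set true] `&`
    ([set: T * measurableTypeR R] `&` [set p | (EFin \o snd) p < (f \o fst) p])).
  apply: measurableI.
    have : measurable_fun [set: T * measurableTypeR R] fsnd by exact: measurable_fun_ler.
    by move=> /(_ measurableT [set true]); rewrite setTI; exact.
  apply: measurable_lte => //.
    apply/measurable_EFinP; exact: measurable_snd.
  exact/measurableT_comp.
by apply/seteqP; split => p /=; rewrite /layer/= ?setTI// => -[? []].
Qed.

Lemma measurable_layer f t : measurable_fun [set: T] f -> measurable (layer f t).
Proof.
move=> mf; have := measurable_ysection t (measurable_layers mf).
by rewrite (_ : ysection _ _ = layer f t)//; apply/seteqP; split=> w;
  rewrite /ysection/= inE.
Qed.

(** With [g] the positive part of [rho] this is the cost of a level set; with [g] constantly 1 it is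
    its measure. *)
Definition layer_integral g f (t : R) : \bar R :=
  \int[mu]_w (g w * (\1_(layer f t) w)%:E).

Let h g f (p : T * measurableTypeR R) : \bar R :=
  g p.1 * (\1_[set p : T * measurableTypeR R | layer f p.2 p.1] p)%:E.

Let hE g f w t : g w * (\1_(layer f t) w)%:E = h g f (w, t).
Proof. by []. Qed.

Let mh g f : measurable_fun [set: T] g -> measurable_fun [set: T] f ->
  measurable_fun [set: T * measurableTypeR R] (h g f).
Proof.
move=> mg mf; apply: emeasurable_funM; first exact: measurableT_comp.
by apply/measurable_EFinP/measurable_indic; exact: measurable_layers.
Qed.

Let h_ge0 g f : (forall w, 0 <= g w) -> forall p, 0 <= h g f p.
Proof. by move=> g0 p; rewrite mule_ge0. Qed.

Lemma measurable_layer_integral g f : measurable_fun [set: T] g ->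
  measurable_fun [set: T] f -> (forall w, 0 <= g w) ->
  measurable_fun [set: measurableTypeR R] (layer_integral g f).
Proof.
move=> mg mf g0.
rewrite (_ : layer_integral g f = fubini_G mu (h g f)).
  by apply: measurable_fun_fubini_tonelli_G; [exact: mh|exact: h_ge0].
by apply/funext => t; apply: eq_integral => w _; rewrite hE.
Qed.

Lemma lebesgue_measure_layers (x : \bar R) : 0 <= x ->
  lebesgue_measure [set t : measurableTypeR R | (0 <= t)%R /\ t%:E < x] = x.
Proof.
case: x => [r| |//] => [r0|_].
- rewrite (_ : [set _ | _] = `[0%R, r[%classic); last first.
    by apply/seteqP; split => t /=; rewrite in_itv/= lte_fin => /andP.
  rewrite lebesgue_measure_itv/= lte_fin; case: ltP => [|r0']; first by rewrite sube0.
  by congr EFin; apply/eqP; rewrite eq_le r0' -lee_fin r0.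
- rewrite (_ : [set _ | _] = `[0%R, +oo[%classic) ?lebesgue_measure_itv/= ?ltry//.
  by apply/seteqP; split => t /=; rewrite in_itv/= andbT ?ltry// => -[].
Qed.

(** [f w] is the length of the set of [t >= 0] below it; writing it as an integral of indicators and
    exchanging the order of integration gives the formula. *)
Lemma layer_cake g f : measurable_fun [set: T] g -> measurable_fun [set: T] f ->
  (forall w, 0 <= g w) -> (forall w, 0 <= f w) ->
  \int[mu]_w (g w * f w) = \int[lebesgue_measure]_t layer_integral g f t.
Proof.
move=> mg mf g0 f0.
under [RHS]eq_integral => t _.
  rewrite /layer_integral; under eq_integral do rewrite hE.
  over.
rewrite -(fubini_tonelli (h g f) (mh mg mf) (h_ge0 f g0)).
apply: eq_integral => w _; under eq_integral do rewrite -hE.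
rewrite ge0_integralZl//.
  congr (_ * _); under eq_integral => t _.
    rewrite (_ : \1_(layer f t) w =
      \1_[set t : measurableTypeR R | (0 <= t)%R /\ t%:E < f w] t); last first.
      by congr (_ : bool)%:R; apply/idP/idP; rewrite !inE.
    over.
  rewrite integral_indic// ?setIT; first by rewrite [RHS]lebesgue_measure_layers.
  have := measurable_xsection w (measurable_layers mf).
  by rewrite (_ : xsection _ _ = [set t | (0 <= t)%R /\ t%:E < f w])//;
    apply/seteqP; split=> t; rewrite /xsection/= inE.
apply/measurable_EFinP.
rewrite (_ : (fun _ => _) = \1_(xsection [set p : T * measurableTypeR R | layer f p.2 p.1] w)).
  by apply: measurable_indic; apply: measurable_xsection; exact: measurable_layers.
by apply/funext => t /=; congr (_ : bool)%:R; apply/idP/idP; rewrite /xsection !inE/= !inE.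
Qed.

Lemma layer_integral1 f t : measurable_fun [set: T] f ->
  layer_integral (cst 1) f t = mu (layer f t).
Proof.
move=> mf; rewrite /layer_integral; under eq_integral do rewrite mul1e.
by rewrite integral_indic ?setIT//; exact: measurable_layer.
Qed.

Lemma layer_cake1 f : measurable_fun [set: T] f -> (forall w, 0 <= f w) ->
  \int[mu]_w f w = \int[lebesgue_measure]_t mu (layer f t).
Proof.
move=> mf f0; under [RHS]eq_integral do rewrite -layer_integral1//.
by rewrite -layer_cake//; apply: eq_integral => w _; rewrite mul1e.
Qed.

Lemma measurable_fun_layer f : measurable_fun [set: T] f ->
  measurable_fun [set: measurableTypeR R] (fun t => mu (layer f t)).
Proof.
move=> mf; under eq_fun do rewrite -layer_integral1//.
exact: measurable_layer_integral.
Qed.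

End layer_cake.

(** * Quantiles: inversion of the distribution function, monotonicity, measurability *)

Section quantile.
Context {d : measure_display} {T : measurableType d} {R : realType}.
Variables (P : probability T R) (X : T -> R).
Hypothesis mX : measurable_fun [set: T] X.
Implicit Types t z u c k : R.

Lemma measurable_le_fun t : measurable [set w | (X w <= t)%R].
Proof.
by have := mX measurableT (measurable_itv `]-oo, t]); rewrite setTI set_itvE.
Qed.

Lemma measurable_gt_fun t : measurable [set w | (t < X w)%R].
Proof.
by have := mX measurableT (measurable_itv `]t, +oo[); rewrite setTI set_itvE.
Qed.

Lemma cdfF_le1 t : cdfF P X t <= 1.
Proof. by apply: probability_le1; exact: measurable_le_fun. Qed.

Lemma cdfF_fin t : cdfF P X t \is a fin_num.
Proof. by apply: fin_num_measure; exact: measurable_le_fun. Qed.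

Lemma le_cdfF s t : (s <= t)%R -> cdfF P X s <= cdfF P X t.
Proof.
move=> st; apply: le_measure; rewrite ?inE; try exact: measurable_le_fun.
by move=> w /= /le_trans; apply.
Qed.

Lemma survival_cdfF t : P [set w | (t < X w)%R] = 1 - cdfF P X t.
Proof.
rewrite (_ : [set w | _] = ~` [set w | (X w <= t)%R]).
  by rewrite probability_setC//; exact: measurable_le_fun.
by apply/seteqP; split => w /=; rewrite ltNge => /negP.
Qed.

Lemma cdfF_cdf t : cdfF P X t = cdf (mfun_Sub (mem_set mX) : {RV P >-> R}) t.
Proof. by rewrite /cdfF /cdf /distribution /pushforward/= -preimage_itvNyc. Qed.

Lemma cdfF_right_continuous : right_continuous (cdfF P X).
Proof.
rewrite (_ : cdfF P X = cdf (mfun_Sub (mem_set mX) : {RV P >-> R})).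
  exact: cdf_right_continuous.
by apply/funext => t; exact: cdfF_cdf.
Qed.

Lemma quantile_open_le z t : z%:E < cdfF P X t -> quantile_open P X z <= t%:E.
Proof. by move=> zF; apply: ereal_inf_lbound; exists t. Qed.

Lemma quantile_open_ge z t : cdfF P X t <= z%:E -> t%:E <= quantile_open P X z.
Proof.
move=> Fz; apply: le_ereal_inf_tmp => _ [s /= zF <-]; rewrite lee_fin leNgt.
apply/negP => /ltW/le_cdfF; rewrite leNgt => /negP; apply.
exact: le_lt_trans zF.
Qed.

Lemma cdfF_le_of_quantile_open z t :
  t%:E < quantile_open P X z -> cdfF P X t <= z%:E.
Proof.
by move=> tz; rewrite leNgt; apply/negP => /quantile_open_le; rewrite leNgt tz.
Qed.

(** Strictness comes from right continuity of the CDF: it is still below [z] at some [s > t], and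
    such an [s] bounds the quantile from below. *)
Lemma lt_quantile_open z t : cdfF P X t < z%:E -> t%:E < quantile_open P X z.
Proof.
move=> Fz.
have Fnear : \forall s \near t^'+, cdfF P X s < z%:E.
  have Ft : cdfF P X @ t^'+ --> cdfF P X t by exact: cdfF_right_continuous.
  apply: (Ft [set y | y < z%:E]); apply: open_nbhs_nbhs.
  by split=> //; exact: open_ereal_lt_ereal.
have [s [ts Fs]] := filter_ex (filterI (nbhs_right_gt t) Fnear).
by rewrite (lt_le_trans (_ : _ < s%:E)) ?lte_fin//; exact/quantile_open_ge/ltW.
Qed.

Lemma quantile_open_homo z u : (z <= u)%R ->
  quantile_open P X z <= quantile_open P X u.
Proof.
move=> zu; apply: ereal_inf_le_tmp => _ [t /= uF <-]; exists t => //=.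
by apply: le_lt_trans uF; rewrite lee_fin.
Qed.

Lemma quantile_in z : (0 < z < 1)%R -> quantile P X z = quantile_open P X z.
Proof.
by move=> /andP[z0 z1]; rewrite /quantile (gt_eqF z0) (lt_eqF z1).
Qed.

Lemma quantile_homo z u : (0 <= z)%R -> (z <= u)%R -> (u <= 1)%R ->
  quantile P X z <= quantile P X u.
Proof.
have half : (0 < (2^-1 : R) < 1)%R by apply/andP; split; lra.
move=> z0 zu u1; rewrite /quantile.
have [{}z0'|z0'] := eqVneq z 0%R; have [u0|u0] := eqVneq u 0%R => //.
- have [u1'|u1'] := eqVneq u 1%R.
    (* From [z = 0] to [u = 1] an infimum over []0, 1[] is compared with a supremum over it; 1/2
       serves as common point. *)
    apply: (@le_trans _ _ (quantile_open P X 2^-1)).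
      by apply: ereal_inf_lbound; exists (2^-1)%R => //=; rewrite in_itv.
    by apply: ereal_sup_ubound; exists (2^-1)%R => //=; rewrite in_itv.
  apply: ereal_inf_lbound; exists u => //=; rewrite in_itv/=.
  by rewrite !lt_neqAle u1 u1' (eq_sym 0%R) u0 -z0' zu.
- by move: z0'; rewrite eq_le z0 -u0 zu.
- have [z1|z1] := eqVneq z 1%R.
    by have -> : (u == 1)%R by rewrite eq_le u1 -z1 zu.
  have [u1'|u1'] := eqVneq u 1%R; last exact: quantile_open_homo.
  apply: ereal_sup_ubound; exists z => //=; rewrite in_itv/=.
  by rewrite !lt_neqAle z1 z0 (le_trans zu u1) (eq_sym 0%R) z0'.
Qed.

(** Monotonicity makes the preimage of each ray within [[0, 1]] an interval. *)
Lemma measurable_quantile :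
  measurable_fun [set: R] (quantile P X \_ `[0%R, 1%R]).
Proof.
apply: (measurable_restrictT _ _).1 => //.
apply: (measurability _ (ErealGenOInfty.measurableE R)) => //.
move=> _ [_ [y ->]] <-; apply: is_interval_measurable => s t /=.
rewrite !in_itv/= !andbT => -[/andP[s0 s1] ys] [/andP[t0 t1] yt] u /andP[su ut].
rewrite !in_itv/= !andbT (le_trans s0 su) (le_trans ut t1); split => //.
by rewrite (lt_le_trans ys)// quantile_homo// (le_trans ut).
Qed.

Lemma cdfF_le_of_quantile z t : (0 <= z <= 1)%R ->
  t%:E < quantile P X z -> cdfF P X t <= z%:E.
Proof.
move=> /andP[z0 z1]; have [->|zn1] := eqVneq z 1%R; first by rewrite cdfF_le1.
rewrite /quantile (negbTE zn1); have [{z0 zn1 z1}->|zn0 tz] := eqVneq z 0%R.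
  (* At [z = 0] the quantile is an infimum over []0, 1[], so the CDF at [t] is at most every [u]
     there, hence at most 0. *)
  move=> tz; have le_itv u : (0 < u < 1)%R -> cdfF P X t <= u%:E.
    move=> u01; apply: cdfF_le_of_quantile_open; apply: lt_le_trans tz _.
    by apply: ereal_inf_lbound; exists u => //=; rewrite in_itv.
  apply/lee_addgt0Pr => e e0; rewrite add0e.
  have [e1|e1] := ltP e 1%R; first by rewrite le_itv ?e0.
  by rewrite (le_trans (cdfF_le1 t))// lee_fin.
exact: cdfF_le_of_quantile_open.
Qed.

(** At [z = 1] the bound by [z] says nothing; but the quantile is a supremum there, so some [u < 1]
    already has its quantile above [t]. *)
Lemma cdfF_lt1_of_quantile t z : (0 <= z <= 1)%R -> t%:E < quantile P X z ->
  cdfF P X t < 1.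
Proof.
move=> /andP[z0 z1]; have [->|zn1] := eqVneq z 1%R; last first.
  move=> tz; apply: (@le_lt_trans _ _ z%:E).
    by apply: cdfF_le_of_quantile => //; rewrite z0 z1.
  by rewrite lte_fin lt_neqAle zn1.
rewrite /quantile oner_eq0 eqxx => /ereal_sup_gt[_ [u /= + <-] tu].
rewrite in_itv/= => /andP[u0 u1].
by rewrite (le_lt_trans (cdfF_le_of_quantile_open tu))// lte_fin.
Qed.

Lemma lt_quantile z t : (0 < z < 1)%R -> cdfF P X t < z%:E ->
  t%:E < quantile P X z.
Proof. by move=> z01 Fz; rewrite quantile_in//; exact: lt_quantile_open. Qed.

(** The CDF tends to 0 and 1 at the two infinities, so real points with CDF below and above [z]
    exist, and they bound the quantile. *)
Lemma quantile_fin z : (0 < z < 1)%R -> quantile P X z \is a fin_num.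
Proof.
move=> z01; have /andP[z0 z1] := z01; rewrite quantile_in//.
pose Y : {RV P >-> R} := mfun_Sub (mem_set mX).
have FY : cdfF P X = cdf Y by apply/funext => t; exact: cdfF_cdf.
have Fy : cdfF P X @ +oo%R --> 1 by rewrite FY; exact: cvg_cdfy1.
have FNy : cdfF P X @ -oo%R --> 0 by rewrite FY; exact: cvg_cdfNy0.
have hiF : \forall s \near +oo%R, z%:E < cdfF P X s.
  apply: (Fy [set y | z%:E < y]); apply: open_nbhs_nbhs; split.
    exact: open_ereal_gt_ereal.
  by rewrite /= lte_fin.
have loF : \forall s \near -oo%R, cdfF P X s < z%:E.
  apply: (FNy [set y | y < z%:E]); apply: open_nbhs_nbhs; split.
    exact: open_ereal_lt_ereal.
  by rewrite /= lte_fin.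
have [s sF] := filter_ex hiF; have [t tF] := filter_ex loF.
rewrite fin_numE -ltNye -ltey; apply/andP; split.
  by rewrite (lt_le_trans (ltNyr t))//; exact/quantile_open_ge/ltW.
by rewrite (le_lt_trans (quantile_open_le sF))// ltry.
Qed.

Lemma quantile_ge0 z : {ae P, forall w, (0 <= X w)%R} -> (0 <= z <= 1)%R ->
  0 <= quantile P X z.
Proof.
move=> X0; have open_ge0 u : (0 < u)%R -> 0 <= quantile_open P X u.
  move=> u0; apply: le_ereal_inf_tmp => _ [t /= uF <-].
  rewrite lee_fin leNgt; apply/negP => t0; move: uF; apply/negP; rewrite -leNgt.
  suff -> : cdfF P X t = 0 by rewrite lee_fin ltW.
  have [N [mN N0 XN]] := X0; apply: (subset_measure0 _ mN _ N0).
    exact: measurable_le_fun.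
  move=> w /= Xt; apply: XN => /= Xw; move: (le_trans Xw Xt).
  by rewrite leNgt t0.
move=> /andP[z0 z1]; apply: (@le_trans _ _ (quantile P X 0)); last first.
  exact: quantile_homo.
rewrite /quantile eqxx; apply: le_ereal_inf_tmp => _ [u /= + <-].
by rewrite in_itv/= => /andP[u0 _]; exact: open_ge0.
Qed.

(** One inequality is right continuity. The other is where the absence of atoms enters: if the CDF
    exceeded [z] at the quantile, left continuity would make it exceed [z] at a smaller point
    too. *)
Lemma cdfF_quantile z : continuous (fun t => fine (cdfF P X t)) ->
  (0 < z < 1)%R -> cdfF P X (fine (quantile P X z)) = z%:E.
Proof.
move=> cF z01; set b := fine _; have bE : b%:E = quantile P X z.
  by rewrite fineK// quantile_fin.
apply/eqP; rewrite eq_le !leNgt; apply/andP; split; apply/negP => Fz; last first.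
  by have := lt_quantile z01 Fz; rewrite -bE ltxx.
have Fnear : \forall s \near b^'-, (z < fine (cdfF P X s))%R.
  have Fb : fine (cdfF P X s) @[s --> b^'-] --> fine (cdfF P X b).
    exact: cvg_at_left_filter (cF b).
  apply: (Fb [set y | (z < y)%R]); apply: open_nbhs_nbhs; split.
    exact: open_gt.
  by rewrite /= -lte_fin fineK ?cdfF_fin.
have [s [sb Fs]] := filter_ex (filterI (nbhs_left_lt b) Fnear).
have /quantile_open_le : z%:E < cdfF P X s by rewrite -[ltRHS]fineK ?cdfF_fin.
by rewrite -quantile_in// -bE lee_fin leNgt sb.
Qed.

End quantile.

(** * Quantile of a payoff with the two values 0 and [k] *)

Section quantile_two_valued.
Context {d : measure_display} {T : measurableType d} {R : realType}.
Variables (P : probability T R) (C : set T) (c k : R).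
Hypotheses (mC : measurable C) (PC : P C = (1 - c)%:E) (c0 : (0 <= c)%R)
  (c1 : (c < 1)%R) (k0 : (0 < k)%R).
Let X w : R := (k * \1_C w)%R.

(** The CDF is [c] on [[0, k[] and 1 from [k] on, so the right-continuous inverse has already jumped
    to [k] at [z = c]. As [c < 1], the endpoint 1 also gets [k]. *)
Lemma quantile_two_valued (z : R) : (0 <= z <= 1)%R ->
  quantile P X z = (k * (c <= z)%R%:R)%:E.
Proof.
have mX : measurable_fun [set: T] X.
  by apply: measurable_funM => //; exact: measurable_indic.
have X0 : {ae P, forall w, (0 <= X w)%R}.
  by apply: aeW => w; rewrite mulr_ge0// ltW.
have PnC : P (~` C) = c%:E.
  by rewrite probability_setC// PC -EFinB opprB addrC subrK.
have lt_open u : (u < c)%R -> quantile_open P X u <= 0.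
  move=> uc; apply: quantile_open_le; rewrite /cdfF.
  rewrite (_ : [set w | _] = ~` C) ?PnC ?lte_fin//.
  apply/seteqP; split => w /=; rewrite /X indicE.
    by case: (boolP (w \in C)) => [_|/negP + _ /mem_set//]; rewrite mulr1 leNgt k0.
  by move=> nC; rewrite memNset// mulr0.
have open_le u : (u < 1)%R -> quantile_open P X u <= k%:E.
  move=> u1; apply: quantile_open_le; rewrite /cdfF.
  rewrite (_ : [set w | _] = setT) ?probability_setT ?lte_fin//.
  apply/seteqP; split => w //= _; rewrite /X indicE.
  by case: (w \in C); rewrite ?mulr1// mulr0 ltW.
have ge_open u : (c <= u)%R -> k%:E <= quantile_open P X u.
  move=> cu; apply: le_ereal_inf_tmp => _ [t /= uF <-]; rewrite lee_fin leNgt.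
  apply/negP => tk; move: uF; apply/negP; rewrite -leNgt.
  apply: (@le_trans _ _ (P (~` C))); last by rewrite PnC lee_fin.
  apply: le_measure; rewrite ?inE; [exact: measurable_le_fun|exact: measurableC|].
  by move=> w /= Xt Cw; move: Xt; rewrite /X indicE mem_set// mulr1 leNgt tk.
have ge0 (u : R) : (0 <= u <= 1)%R -> 0 <= quantile P X u by exact: quantile_ge0.
move=> z01; have /andP[z0 z1] := z01.
have [cz|zc] := leP c z; rewrite ?mulr1 ?mulr0; apply/eqP; rewrite eq_le.
- apply/andP; split.
    apply: (@le_trans _ _ (quantile P X 1)); first exact: quantile_homo.
    rewrite /quantile oner_eq0 eqxx; apply: ge_ereal_sup => _ [u /= + <-].
    by rewrite in_itv/= => /andP[_ u1]; exact: open_le.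
  apply: (@le_trans _ _ (quantile P X c)); last exact: quantile_homo.
  rewrite /quantile (lt_eqF c1); case: ifPn => [/eqP cE|_]; last exact: ge_open.
  apply: le_ereal_inf_tmp => _ [u /= + <-]; rewrite in_itv/= => /andP[u0 u1].
  by apply: ge_open; rewrite cE ltW.
- rewrite (ge0 _ z01) andbT; rewrite /quantile (lt_eqF (lt_trans zc c1)).
  case: ifPn => [/eqP zE|_]; last exact: lt_open.
  have c_gt0 : (0 < c)%R by rewrite -zE.
  (* The value at 0 is an infimum over []0, 1[], so one point of it strictly below [c] is enough. *)
  have half_lt : (c / 2 < c)%R by rewrite ltr_pdivrMr// ltr_pMr// ltr1n.
  apply: (@le_trans _ _ (quantile_open P X (c / 2))).
    apply: ereal_inf_lbound; exists (c / 2)%R => //=; rewrite in_itv/=.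
    by rewrite divr_gt0//= (lt_trans _ c1).
  exact: lt_open.
Qed.

End quantile_two_valued.

(** * Cost of an event under the pricing kernel, and the cheapest event of given probability *)

Section pricing_kernel.
Context {d : measure_display} {T : measurableType d} {R : realType}.
Variables (P : probability T R) (rho : T -> R).
Hypotheses (mrho : measurable_fun [set: T] rho)
  (rho_gt0 : {ae P, forall w, (0 < rho w)%R})
  (irho : P.-integrable [set: T] (EFin \o rho)).
Implicit Types (B C : set T) (c t : R).

(* The positive part is harmless as [rho > 0] almost surely, and makes the
   integrand nonnegative everywhere. *)
Definition cost B : \bar R :=
  \int[P]_w ((rho^\+%R w)%:E * (\1_B w)%:E).

Lemma measurable_pos : measurable_fun [set: T] (EFin \o rho^\+%R).
Proof. by apply/measurable_EFinP; exact: measurable_funrpos. Qed.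

Lemma pos_ge0 w : 0 <= (EFin \o rho^\+%R) w.
Proof. by rewrite lee_fin funrpos_ge0. Qed.

Lemma measurable_costM B : measurable B ->
  measurable_fun [set: T] (fun w => (rho^\+%R w)%:E * (\1_B w)%:E).
Proof.
move=> mB; apply: emeasurable_funM; first exact: measurable_pos.
by apply/measurable_EFinP; exact: measurable_indic.
Qed.

Lemma ae_pos : {ae P, forall w, rho^\+%R w = rho w}.
Proof.
by apply: filterS rho_gt0 => w /ltW r0; rewrite /funrpos; apply/max_idPl.
Qed.

Lemma integral_pos_mul (Y : T -> R) : measurable_fun [set: T] Y ->
  {ae P, forall w, (0 <= Y w)%R} ->
  \int[P]_w (rho w * Y w)%:E =
  \int[P]_w ((rho^\+%R w)%:E * (Y^\+%R w)%:E).
Proof.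
move=> mY Y0; apply: ae_eq_integral => //.
- by apply/measurable_EFinP; exact: measurable_funM.
- apply: emeasurable_funM; first exact: measurable_pos.
  by apply/measurable_EFinP; exact: measurable_funrpos.
- apply: filterS2 Y0 ae_pos => w Yw rw _; rewrite -EFinM rw; congr (_ * _)%:E.
  by rewrite /funrpos; apply/esym/max_idPl.
Qed.

Lemma integral_indic_cost B : measurable B ->
  \int[P]_w (rho w * \1_B w)%:E = cost B.
Proof.
move=> mB; apply: ae_eq_integral => //.
- by apply/measurable_EFinP; exact: measurable_funM.
- exact: measurable_costM.
- by apply: filterS ae_pos => w rw _; rewrite -EFinM rw.
Qed.

Lemma costT : cost [set: T] = \int[P]_w (rho w)%:E.
Proof.
rewrite -integral_indic_cost//; apply: eq_integral => w _.
by rewrite indicT mulr1.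
Qed.

Lemma le_cost B C : measurable B -> measurable C -> B `<=` C -> cost B <= cost C.
Proof.
move=> mB mC BC; apply: ge0_le_integral => //.
- by move=> w _; rewrite mule_ge0// lee_fin funrpos_ge0.
- exact: measurable_costM.
- exact: measurable_costM.
- move=> w _; rewrite -!EFinM lee_fin ler_wpM2l ?funrpos_ge0//.
  rewrite !indicE ler_nat; case: (boolP (w \in B)) => // wB.
  by rewrite mem_set//; apply: BC; rewrite inE in wB.
Qed.

Lemma cost_ge0 B : 0 <= cost B.
Proof. by apply: integral_ge0 => w _; rewrite mule_ge0// lee_fin funrpos_ge0. Qed.

Lemma cost_fin B : measurable B -> cost B \is a fin_num.
Proof.
move=> mB; rewrite ge0_fin_numE ?cost_ge0//.
apply: le_lt_trans (le_cost mB measurableT (@subsetT _ _)) _.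
by rewrite costT ltey_eq integrable_fin_num.
Qed.

(** Zero cost would make [rho] vanish almost everywhere on [B], against [rho > 0]. *)
Lemma cost_gt0 B : measurable B -> 0 < P B -> 0 < cost B.
Proof.
move=> mB PB; rewrite lt_neqAle cost_ge0 andbT; apply/eqP => /esym cB0.
have : \int[P]_w `|(rho^\+%R w)%:E * (\1_B w)%:E| = 0.
  rewrite -[RHS]cB0; apply: eq_integral => w _.
  by rewrite gee0_abs// mule_ge0// lee_fin funrpos_ge0.
move=> /(ae_eq_integral_abs _ measurableT (measurable_costM mB)).1 ae0.
suff : P B = 0 by move=> PB0; rewrite PB0 ltxx in PB.
have [N [mN N0 BN]] : {ae P, forall w, ~ B w}.
  apply: filterS2 ae0 rho_gt0 => w /(_ I) + rw Bw.
  rewrite indicE mem_set// mule1 => -[]; rewrite /funrpos => /eqP.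
  by rewrite (max_idPl (ltW rw)) gt_eqF.
by apply: (subset_measure0 mB mN _ N0) => w Bw; apply: BN => /=; apply.
Qed.

Hypothesis crho : continuous (fun t => fine (cdfF P rho t)).

Definition threshold c : R := fine (quantile P rho (1 - c)%R).

Definition cheap c : set T := [set w | (rho w <= threshold c)%R].

Lemma measurable_cheap c : measurable (cheap c).
Proof. exact: measurable_le_fun. Qed.

Lemma itv01C c : (0 < c < 1)%R -> (0 < 1 - c < 1)%R.
Proof. by move=> /andP[c0 c1]; rewrite subr_gt0 c1 gtrBl. Qed.

Lemma cheapE c : (0 < c < 1)%R -> P (cheap c) = (1 - c)%:E.
Proof. by move=> /itv01C c01; exact: cdfF_quantile. Qed.

(** Phrased with the same case split as [layer_q], so that the two can be equated level by level in
    [cost_cheap]. *)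
Lemma cheap_cdfF c t : (0 < c < 1)%R -> (0 <= t)%R ->
  P [set w | (t < rho w <= threshold c)%R] =
  if (c < 1 - fine (cdfF P rho t))%R then (1 - fine (cdfF P rho t) - c)%:E else 0.
Proof.
move=> c01 t0; have Fb := cheapE c01; have Ft := cdfF_fin P mrho t.
have [tb|bt] := leP t (threshold c).
  rewrite (_ : [set w | _] = cheap c `\` [set w | (rho w <= t)%R]); last first.
    apply/seteqP; split => w /=.
      by move=> /andP[tw wb]; split => //; apply/negP; rewrite -ltNge.
    by move=> [wb /negP]; rewrite -ltNge => ->.
  rewrite measureD; [|exact: measurable_cheap|exact: measurable_le_fun|].
    2: by rewrite [X in X < _]Fb ltry.
  rewrite (_ : _ `&` _ = [set w | (rho w <= t)%R]); last first.
    by apply/seteqP; split => w /= => [[]//|wt]; split => //; exact: le_trans tb.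
  rewrite [X in X - _]Fb [X in _ - X](_ : _ = cdfF P rho t)// -{1}(fineK Ft) -EFinB.
  have := le_cdfF P mrho tb; rewrite [X in _ <= X]Fb -(fineK Ft) lee_fin fineK//.
  move=> Ftc; case: ltP => cF; first by congr EFin; rewrite addrAC.
  by congr EFin; apply/eqP; rewrite subr_eq0; apply/eqP/le_anti; lra.
rewrite (_ : [set w | _] = set0) ?measure0; last first.
  apply/seteqP; split => w //= /andP[tw wb].
  by have := lt_trans bt (lt_le_trans tw wb); rewrite ltxx.
have : (1 - c)%:E <= cdfF P rho t by rewrite -Fb; exact: (le_cdfF P mrho (ltW bt)).
rewrite -(fineK Ft) lee_fin => Ftc.
by rewrite ltNge (_ : _ <= _)%R//; lra.
Qed.

Let q c : R -> \bar R := (fun z => quantile P rho (1 - z)%R) \_ `[c, 1%R].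

Let mq c : (0 < c < 1)%R -> measurable_fun [set: measurableTypeR R] (q c).
Proof.
move=> /andP[c0 c1].
(* The reflection of [z] to [1 - z] maps [[c, 1]] into [[0, 1]], where the quantile is known to be
   measurable. *)
have -> : q c = ((quantile P rho \_ `[0%R, 1%R]) \o (fun z => 1 - z)%R) \_ `[c, 1%R].
  apply/funext => z; rewrite /q !patchE; case: ifPn => //.
  rewrite inE/= in_itv/= => /andP[cz z1]; rewrite /= patchE mem_set//= in_itv/=.
  by rewrite subr_ge0 z1 gerBl (le_trans (ltW c0)).
apply/(measurable_restrictT _ _).1 => //; apply: measurable_funTS.
apply: measurableT_comp; first exact: measurable_quantile.
exact: measurable_funB.
Qed.

Let q_ge0 c z : (0 < c < 1)%R -> 0 <= q c z.
Proof.
move=> /andP[c0 c1]; rewrite /q patchE; case: ifPn => //.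
rewrite inE/= in_itv/= => /andP[cz z1]; apply: quantile_ge0 => //.
  by apply: filterS rho_gt0 => w /ltW.
by rewrite subr_ge0 z1 gerBl (le_trans (ltW c0)).
Qed.

(** By inversion of the CDF the layer lies between the open and the closed interval from [c] to
    [1 - F], which have equal length. *)
Lemma layer_q c t : (0 < c < 1)%R -> (0 <= t)%R ->
  lebesgue_measure (layer (q c) t) =
  if (c < 1 - fine (cdfF P rho t))%R then (1 - fine (cdfF P rho t) - c)%:E else 0.
Proof.
move=> c01 t0; have /andP[c0 c1] := c01; set F := fine _.
have Ft : cdfF P rho t = F%:E by rewrite fineK// cdfF_fin.
have F0 : (0 <= F)%R by rewrite fine_ge0.
have mL : measurable (layer (q c) t) by apply: measurable_layer; exact: mq.
have qE z : (c <= z <= 1)%R -> q c z = quantile P rho (1 - z)%R.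
  by move=> cz; rewrite /q patchE mem_set//= in_itv.
have le_itv : layer (q c) t `<=` `[c, (1 - F)%R].
  move=> z [_]; rewrite /q patchE; case: ifPn; last by rewrite lte_fin ltNge t0.
  rewrite inE/= in_itv/= => /andP[cz z1] tz; rewrite in_itv/= cz/=.
  have : cdfF P rho t <= (1 - z)%:E.
    apply: cdfF_le_of_quantile => //.
    by rewrite subr_ge0 z1 gerBl (le_trans (ltW c0)).
  by rewrite Ft lee_fin; lra.
have ge_itv : `]c, (1 - F)%R[ `<=` layer (q c) t.
  move=> z /=; rewrite in_itv/= => /andP[cz zF]; split => //.
  have z1 : (z < 1)%R by rewrite (lt_le_trans zF)// gerBl.
  rewrite qE ?(ltW cz) ?(ltW z1)//; apply: lt_quantile => //.
    by apply: itv01C; rewrite z1 (lt_trans c0).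
  by rewrite Ft lte_fin; lra.
apply/eqP; rewrite eq_le; apply/andP; split.
  apply: (@le_trans _ _ (lebesgue_measure `[c, (1 - F)%R])).
    by apply: le_measure; rewrite ?inE.
  by rewrite lebesgue_measure_itv/= lte_fin.
apply: (@le_trans _ _ (lebesgue_measure `]c, (1 - F)%R[)).
  by rewrite lebesgue_measure_itv/= lte_fin.
by apply: le_measure; rewrite ?inE.
Qed.

(** The change of variables from quantile to [rho] goes through the layer-cake formula: the length
    of the part of [[c, 1]] where the reflected quantile exceeds [t >= 0] is the probability that
    [rho] exceeds [t] on [cheap c]. *)
Lemma cost_cheap c : (0 < c < 1)%R ->
  \int[lebesgue_measure]_(z in `[c, 1%R]) quantile P rho (1 - z)%R =
  cost (cheap c).
Proof.
move=> c01; rewrite integral_mkcond -/(q c).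
rewrite (layer_cake1 _ (@mq c c01) (fun z => @q_ge0 c z c01)).
pose f w := (rho^\+%R w)%:E * (\1_(cheap c) w)%:E.
have mf : measurable_fun [set: T] f.
  by apply: measurable_costM; exact: measurable_cheap.
have f0 w : 0 <= f w by rewrite mule_ge0// lee_fin funrpos_ge0.
rewrite (_ : cost _ = \int[P]_w f w)// (layer_cake1 _ mf f0).
apply: eq_integral => t _.
have [t0|t0] := leP 0%R t; last first.
  by rewrite (_ : layer _ _ = set0) ?measure0 1?(_ : layer _ _ = set0) ?measure0//;
    apply/seteqP; split => w // []; rewrite leNgt t0.
rewrite [LHS]layer_q// -cheap_cdfF//; congr (P _).
apply/seteqP; split => w /=.
  move=> /andP[tw wb]; split => //; rewrite /f indicE mem_set// mule1 lte_fin.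
  by rewrite /funrpos lt_max tw.
move=> [_]; rewrite /f indicE; case: (boolP (w \in cheap c)) => [|_].
  by rewrite inE mule1 lte_fin /funrpos lt_max [(t < 0)%R]ltNge t0 orbF => -> ->.
by rewrite mule0 lte_fin ltNge t0.
Qed.

(* Pointwise, [rho 1_B + b 1_C >= rho 1_C + b 1_B] for [C = {rho <= b}]. *)
Lemma cost_cheap_le c B : (0 < c < 1)%R -> measurable B ->
  P B = (1 - c)%:E -> cost (cheap c) <= cost B.
Proof.
move=> c01 mB PB; have mC := measurable_cheap c; set b := threshold c.
have b0 : (0 <= b)%R.
  apply: fine_ge0; apply: quantile_ge0 => //.
    by apply: filterS rho_gt0 => w /ltW.
  by have /andP[/ltW -> /ltW ->] := itv01C c01.
have mb (D : set T) : measurable D -> measurable_fun [set: T] (fun w => b%:E * (\1_D w)%:E).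
  move=> mD; apply: emeasurable_funM => //.
  by apply/measurable_EFinP; exact: measurable_indic.
have costD (C D : set T) : measurable C -> measurable D ->
    \int[P]_w ((rho^\+%R w)%:E * (\1_C w)%:E + b%:E * (\1_D w)%:E) =
    cost C + b%:E * P D.
  move=> mC' mD; rewrite ge0_integralD//; last 4 first.
  - by move=> w _; rewrite mule_ge0// lee_fin funrpos_ge0.
  - exact: measurable_costM.
  - by move=> w _; rewrite mule_ge0.
  - exact: mb.
  congr (_ + _); rewrite ge0_integralZl//; first by rewrite integral_indic ?setIT.
  by apply/measurable_EFinP; exact: measurable_indic.
(* Both events have probability [1 - c], so the added terms are equal and finite, and cancel. *)
suff : cost (cheap c) + b%:E * P B <= cost B + b%:E * P (cheap c).
  by rewrite PB cheapE// -EFinM leeD2rE.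
rewrite -!costD//; apply: ge0_le_integral => //.
- by move=> w _; rewrite adde_ge0// mule_ge0// lee_fin ?funrpos_ge0.
- by apply: emeasurable_funD; [exact: measurable_costM|exact: mb].
- by apply: emeasurable_funD; [exact: measurable_costM|exact: mb].
move=> w _; rewrite !indicE.
case: (boolP (w \in cheap c)) => wC; case: (boolP (w \in B)) => wB;
  rewrite ?mule1 ?mule0 ?adde0 ?add0e// lee_fin.
  by rewrite inE in wC; rewrite /funrpos ge_max b0 andbT.
by move/negP: wC; rewrite inE => /negP; rewrite -ltNge => /ltW; rewrite /funrpos le_max => ->.
Qed.

End pricing_kernel.

(** * The investment problem: payoff-to-cost ratios and the upper bound on [V] *)

Section portfolio.
Context {d : measure_display} {T : measurableType d} {R : realType}.
Variables (P : probability T R) (rho : T -> R) (m : probability R R) (x : R).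
Hypotheses (mrho : measurable_fun [set: T] rho)
  (rho_gt0 : {ae P, forall w, (0 < rho w)%R})
  (irho : P.-integrable [set: T] (EFin \o rho))
  (crho : continuous (fun t => fine (cdfF P rho t)))
  (m01 : m `[0%R, 1%R]%classic = 1)
  (x_gt0 : (0 < x)%R).
Implicit Types (X : T -> R) (c t M : R).

Notation cost := (cost P rho).
Notation cheap := (cheap P rho).
Notation threshold := (threshold P rho).
Notation zeta := (zeta P m rho).

Let delta : R := fine (\int[P]_w (rho w)%:E).
Let phi c : R :=
  fine (\int[lebesgue_measure]_(z in `[c, 1%R]) quantile P rho (1 - z)%R).

Let cost_finite B : measurable B -> cost B \is a fin_num.
Proof. exact: cost_fin. Qed.

Let cost_pos B : measurable B -> 0 < P B -> 0 < cost B.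
Proof. exact: cost_gt0. Qed.

Lemma deltaE : delta%:E = cost [set: T].
Proof. by rewrite /delta -costT// fineK// cost_finite. Qed.

Lemma delta_gt0 : (0 < delta)%R.
Proof. by rewrite -lte_fin deltaE cost_pos// probability_setT. Qed.

Lemma phiE c : (0 < c < 1)%R -> (phi c)%:E = cost (cheap c).
Proof.
by move=> c01; rewrite /phi cost_cheap// fineK// cost_finite//; exact: measurable_cheap.
Qed.

Lemma phi_gt0 c : (0 < c < 1)%R -> (0 < phi c)%R.
Proof.
move=> c01; rewrite -lte_fin phiE// cost_pos//; first exact: measurable_cheap.
by rewrite cheapE// lte_fin subr_gt0; case/andP : c01.
Qed.

Lemma zeta_phi c : (0 < c < 1)%R -> m `[c, 1%R]%classic = (zeta c * phi c)%:E.
Proof.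
move=> c01; rewrite /Defs.zeta -/(phi c) divfK ?gt_eqF ?phi_gt0//.
by rewrite fineK// fin_num_measure.
Qed.

Lemma zeta_ge0 c : (0 < c < 1)%R -> (0 <= zeta c)%R.
Proof. by move=> c01; apply: divr_ge0; [exact: fine_ge0|exact/ltW/phi_gt0]. Qed.

(** Extended by 0 outside [[0, 1]], so that layers at levels [t >= 0] stay inside [[0, 1]]. *)
Let quantile01 X : R -> \bar R := quantile P X \_ `[0%R, 1%R].

(* [r] is [1 / delta] when [X > t] almost surely, and otherwise [zeta c] for
   [c = F_X t]. *)
Lemma layer_quantile_ratio X t : measurable_fun [set: T] X -> (0 <= t)%R ->
  m (layer (quantile01 X) t) = 0 \/
  exists r, [/\ r = delta^-1%R \/ exists2 c, (0 < c < 1)%R & r = zeta c,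
    0 < cost [set w | (t < X w)%R] &
    m (layer (quantile01 X) t) <= r%:E * cost [set w | (t < X w)%R]].
Proof.
move=> mX t0; set B := [set w | _]; set L := layer _ _.
have mB : measurable B by exact: measurable_gt_fun.
have mL : measurable L by apply: measurable_layer; exact: measurable_quantile.
have PB : P B = 1 - cdfF P X t by exact: survival_cdfF.
have LE z : L z -> (0 <= z <= 1)%R /\ t%:E < quantile P X z.
  move=> [_]; rewrite /quantile01 patchE; case: ifPn => [|_].
    by rewrite inE/= in_itv.
  by rewrite lte_fin ltNge t0.
(* If [X <= t] almost surely, no quantile exceeds [t], not even at 1, and the layer is empty. *)
have [F1|F1] := eqVneq (cdfF P X t) 1.
  left; rewrite (_ : L = set0) ?measure0//; apply/seteqP; split => z // Lz.
  by have [z01 tz] := LE _ Lz; have := cdfF_lt1_of_quantile mX z01 tz; rewrite F1 ltxx.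
have {}F1 : cdfF P X t < 1 by rewrite lt_neqAle F1 cdfF_le1.
have PB0 : 0 < P B by rewrite PB sube_gt0.
right; have [F0|F0] := eqVneq (cdfF P X t) 0.
  exists delta^-1%R; split; [by left|exact: cost_pos|].
  (* Here [X > t] almost surely, so [B] costs as much as the whole space. *)
  suff -> : cost B = delta%:E.
    by rewrite -EFinM mulVf ?gt_eqF ?delta_gt0//; exact: probability_le1.
  rewrite deltaE; apply: ae_eq_integral => //; try exact: measurable_costM.
  have PnB : P (~` B) = 0 by rewrite probability_setC// PB F0 sube0 subee.
  exists (~` B); split; [exact: measurableC|exact: PnB|].
  by move=> w; apply: contra_not => Bw _; rewrite !indicE !mem_set.
have F_fin := cdfF_fin P mX t; set c := fine (cdfF P X t).
have FE : cdfF P X t = c%:E by rewrite fineK.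
have c01 : (0 < c < 1)%R.
  by rewrite -!lte_fin -FE F1 andbT lt_neqAle eq_sym F0/= measure_ge0.
exists (zeta c); split; [by right; exists c|exact: cost_pos|].
(* The layer lies in [[c, 1]], whose mass is [zeta c] times the cost of [cheap c]; [B] has the same
   probability [1 - c] and costs at least as much. *)
apply: (@le_trans _ _ (m `[c, 1%R]%classic)).
  apply: le_measure; rewrite ?inE// => z Lz; have [z01 tz] := LE _ Lz.
  have := cdfF_le_of_quantile mX z01 tz; rewrite FE lee_fin => cz.
  by rewrite /= in_itv/= cz; case/andP : z01.
rewrite zeta_phi// EFinM lee_wpmul2l ?lee_fin ?zeta_ge0// phiE//.
by apply: cost_cheap_le => //; rewrite PB FE.
Qed.

Lemma Vfun_layer X : measurable_fun [set: T] X ->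
  {ae P, forall w, (0 <= X w)%R} ->
  Vfun P m X = \int[lebesgue_measure]_t m (layer (quantile01 X) t).
Proof.
move=> mX X0; rewrite /Vfun integral_mkcond -layer_cake1//.
  exact: measurable_quantile.
by move=> z; rewrite /quantile01 patchE; case: ifPn => //;
  rewrite inE/= in_itv/= => z01; exact: quantile_ge0.
Qed.

Let posX X : T -> \bar R := EFin \o X^\+%R.

Lemma budget_layer X : measurable_fun [set: T] X ->
  {ae P, forall w, (0 <= X w)%R} ->
  \int[P]_w (rho w * X w)%:E =
  \int[lebesgue_measure]_t cost (layer (posX X) t).
Proof.
move=> mX X0; rewrite integral_pos_mul//.
by apply: (layer_cake P (measurable_pos mrho) (measurable_pos mX) (pos_ge0 _) (pos_ge0 _)).
Qed.

Lemma layer_posE X t : (0 <= t)%R -> layer (posX X) t = [set w | (t < X w)%R].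
Proof.
move=> t0; apply/seteqP; split => w; rewrite /layer /posX /= /funrpos lte_fin lt_max.
  by rewrite [(t < 0)%R]ltNge t0 orbF => -[].
by move=> ->.
Qed.

Lemma layer_lt0 d' (S : measurableType d') (f : S -> \bar R) t :
  (t < 0)%R -> layer f t = set0.
Proof. by move=> t0; apply/seteqP; split => w // []; rewrite leNgt t0. Qed.

Lemma layer_quantile_le X M t : measurable_fun [set: T] X ->
  (delta^-1 <= M)%R -> (forall c, (0 < c < 1)%R -> (zeta c <= M)%R) ->
  m (layer (quantile01 X) t) <= M%:E * cost (layer (posX X) t).
Proof.
move=> mX dM zM; have M0 : (0 <= M)%R.
  by apply: le_trans dM; rewrite invr_ge0 ltW// delta_gt0.
have [t0|t0] := leP 0%R t; last first.
  by rewrite layer_lt0// measure0 mule_ge0// cost_ge0.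
rewrite layer_posE//; have [->|[r [rE cB mr]]] := layer_quantile_ratio mX t0.
  by rewrite mule_ge0// cost_ge0.
apply: (le_trans mr); apply: lee_wpmul2r; first exact: ltW.
by rewrite lee_fin; case: rE => [->//|[c c01 ->]]; exact: zM.
Qed.

(** The level bounds are integrated over [t]: by the layer-cake formula they add up to [V X] on one
    side and to [M] times the budget spent on the other. *)
Lemma Vfun_le X M : feasible P rho x X -> (delta^-1 <= M)%R ->
  (forall c, (0 < c < 1)%R -> (zeta c <= M)%R) -> Vfun P m X <= (M * x)%:E.
Proof.
move=> [mX X0 bX] dM zM; have M0 : (0 <= M)%R.
  by apply: le_trans dM; rewrite invr_ge0 ltW// delta_gt0.
rewrite EFinM; apply: le_trans (lee_wpmul2l _ bX); last by rewrite lee_fin.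
have mq : measurable_fun [set: measurableTypeR R] (quantile01 X).
  exact: measurable_quantile.
rewrite Vfun_layer// budget_layer// -ge0_integralZl//; last 2 first.
- exact: (measurable_layer_integral P (measurable_pos mrho) (measurable_pos mX) (pos_ge0 _)).
- by move=> t _; exact: cost_ge0.
apply: ge0_le_integral => //.
- exact: measurable_fun_layer.
- apply: emeasurable_funM => //.
  exact: (measurable_layer_integral P (measurable_pos mrho) (measurable_pos mX) (pos_ge0 _)).
- by move=> t _; exact: layer_quantile_le.
Qed.

(* Equality would force the two level-set integrands to agree almost everywhere,
   hence every level to be null and [V X = 0]. *)
Lemma Vfun_lt X M : feasible P rho x X -> (delta^-1 < M)%R ->
  (forall c, (0 < c < 1)%R -> (zeta c < M)%R) -> Vfun P m X < (M * x)%:E.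
Proof.
move=> fX dM zM; have zM' c : (0 < c < 1)%R -> (zeta c <= M)%R.
  by move=> /zM/ltW.
have M0 : (0 < M)%R by apply: lt_trans dM; rewrite invr_gt0 delta_gt0.
rewrite lt_neqAle Vfun_le ?(ltW dM)// andbT; apply/eqP => VM.
have [mX X0 bX] := fX.
have mq : measurable_fun [set: measurableTypeR R] (quantile01 X).
  exact: measurable_quantile.
pose h1 t := m (layer (quantile01 X) t).
pose h2 t := M%:E * cost (layer (posX X) t).
have mh1 : measurable_fun [set: measurableTypeR R] h1 by exact: measurable_fun_layer.
have mcost : measurable_fun [set: measurableTypeR R] (fun t => cost (layer (posX X) t)).
  exact: (measurable_layer_integral P (measurable_pos mrho) (measurable_pos mX) (pos_ge0 _)).
have mh2 : measurable_fun [set: measurableTypeR R] h2 by exact: emeasurable_funM.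
have h12 t : h1 t <= h2 t by apply: layer_quantile_le => //; exact: ltW.
have h1_fin t : h1 t \is a fin_num.
  by rewrite fin_num_measure//; exact: measurable_layer.
have I1 : \int[lebesgue_measure]_t h1 t = (M * x)%:E by rewrite -Vfun_layer.
have I2 : \int[lebesgue_measure]_t h2 t <= (M * x)%:E.
  rewrite ge0_integralZl//; last 2 first.
  - by move=> t _; exact: cost_ge0.
  - by rewrite lee_fin ltW.
  by rewrite -budget_layer// EFinM lee_wpmul2l// lee_fin ltW.
have mg : measurable_fun [set: measurableTypeR R] (h2 \- h1) by exact: emeasurable_funB.
have g0 t : 0 <= (h2 \- h1) t by rewrite sube_ge0// h1_fin.
(* [h1] integrates to [M * x] and [h2] to at most that, so the nonnegative gap integrates to 0. *)
have Ig : \int[lebesgue_measure]_t (h2 \- h1) t = 0.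
  apply/eqP; rewrite eq_le integral_ge0// andbT.
  have : \int[lebesgue_measure]_t (h1 t + (h2 \- h1) t) <= (M * x)%:E.
    by apply: le_trans I2; under eq_integral do rewrite addeC subeK//.
  rewrite ge0_integralD//.
  by rewrite I1 -[X in _ <= X -> _]adde0 leeD2lE.
have ae12 : ae_eq lebesgue_measure [set: measurableTypeR R] (h2 \- h1) (cst 0).
  apply/ae_eq_integral_abs => //; rewrite -[RHS]Ig.
  by apply: eq_integral => t _; rewrite gee0_abs.
(* Where the gap vanishes, the level is null: otherwise a ratio [r < M] and a positive finite cost
   would make the gap positive. *)
have ae1 : ae_eq lebesgue_measure [set: measurableTypeR R] h1 (cst 0).
  apply: filterS ae12 => t /(_ I) /= h21_0 _.
  have h21 : h2 t = h1 t by rewrite -[LHS](subeK _ (h1_fin t)) h21_0 add0e.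
  have [t0|t0] := leP 0%R t; last by rewrite /h1 layer_lt0// measure0.
  have [//|[r [rE cB mr]]] := layer_quantile_ratio mX t0.
  exfalso; move: mr; apply/negP; rewrite -ltNge -/(h1 t) -h21 /h2 layer_posE//.
  rewrite lte_pmul2r//; last by apply: cost_finite; exact: measurable_gt_fun.
  by rewrite lte_fin; case: rE => [->//|[c c01 ->]]; exact: zM.
have : \int[lebesgue_measure]_t h1 t = \int[lebesgue_measure]_t cst 0 t.
  exact: ae_eq_integral.
rewrite I1 integral0 => -[] /eqP.
by rewrite mulf_eq0 !gt_eqF.
Qed.

(** * Payoffs realising the ratios: digital claims and the constant *)

Lemma Vfun_two_valued C c k : measurable C -> P C = (1 - c)%:E ->
  (0 <= c)%R -> (c < 1)%R -> (0 < k)%R ->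
  Vfun P m (fun w => k * \1_C w)%R = k%:E * m `[c, 1%R]%classic.
Proof.
move=> mC PC c0 c1 k0; rewrite /Vfun.
under eq_integral => z /[!inE]/= /[!in_itv]/= z01.
  rewrite (quantile_two_valued mC PC c0 c1 k0 z01).
  rewrite (_ : (c <= z)%R%:R = \1_(`[c, 1%R]) z :> R); last first.
    rewrite indicE; congr (_ : bool)%:R; apply/idP/idP.
      by move=> cz; rewrite mem_set//= in_itv/= cz; case/andP : z01.
    by rewrite inE/= in_itv/= => /andP[].
  rewrite EFinM.
  over.
rewrite ge0_integralZl//; last 2 first.
- by apply/measurable_EFinP; exact: measurable_indic.
- by rewrite lee_fin ltW.
rewrite integral_indic//; congr (_ * m _); apply/setIidPl => z /=.
by rewrite !in_itv/= => /andP[cz ->]; rewrite (le_trans c0).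
Qed.

Let digital_c c := digital P rho x (threshold c).

Lemma digitalE c : (0 < c < 1)%R ->
  digital_c c = (fun w => x / phi c * \1_(cheap c) w)%R.
Proof.
move=> c01; rewrite /digital_c /digital integral_indic_cost//; last exact: measurable_cheap.
by rewrite -/(cheap c) -phiE.
Qed.

Lemma feasible_digital c : (0 < c < 1)%R -> feasible P rho x (digital_c c).
Proof.
move=> c01; have mC := measurable_cheap P mrho c; have phi0 := phi_gt0 c01.
have k0 : (0 <= x / phi c)%R by rewrite divr_ge0// ltW.
have mY : measurable_fun [set: T] (fun w => x / phi c * \1_(cheap c) w)%R.
  by apply: measurable_funM => //; exact: measurable_indic.
have Y0 : {ae P, forall w, (0 <= x / phi c * \1_(cheap c) w)%R}.
  by apply: aeW => w; rewrite mulr_ge0.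
rewrite digitalE//; split => //; rewrite integral_pos_mul//.
under eq_integral => w _.
  rewrite [X in _ * X](_ : _ = (x / phi c)%:E * (\1_(cheap c) w)%:E); last first.
    by rewrite -EFinM /funrpos (max_idPl _)// mulr_ge0.
  rewrite muleCA.
  over.
rewrite ge0_integralZl//; last 2 first.
- exact: measurable_costM.
- by move=> w _; rewrite mule_ge0// lee_fin funrpos_ge0.
by rewrite -/(cost _) -phiE// -EFinM divfK// gt_eqF.
Qed.

(** The payoff holds [x / phi c] units, each worth [m[c, 1]], that is [zeta c * phi c]. *)
Lemma Vfun_digital c : (0 < c < 1)%R -> Vfun P m (digital_c c) = (zeta c * x)%:E.
Proof.
move=> c01; have phi0 := phi_gt0 c01; have /andP[c0 c1] := c01.
rewrite digitalE// (@Vfun_two_valued _ c) ?divr_gt0//.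
- by rewrite zeta_phi// -EFinM mulrCA divfK// gt_eqF.
- exact: measurable_cheap.
- exact: cheapE.
- exact: ltW.
Qed.

Lemma feasible_cst : feasible P rho x (fun=> x / delta)%R.
Proof.
split => //.
- by apply: aeW => w; rewrite divr_ge0// ltW// delta_gt0.
- under eq_integral do rewrite mulrC EFinM.
  by rewrite integralZl// -costT// -deltaE -EFinM divfK// gt_eqF// delta_gt0.
Qed.

(** The constant is the two-valued payoff on the whole space with [c = 0], and [m] gives [[0, 1]]
    full mass. *)
Lemma Vfun_cst : Vfun P m (fun=> x / delta)%R = (delta^-1 * x)%:E.
Proof.
rewrite (_ : (fun=> _) = fun w => x / delta * \1_[set: T] w)%R; last first.
  by apply/funext => w; rewrite indicT mulr1.
rewrite (@Vfun_two_valued _ 0%R)//.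
- by rewrite m01 mule1 mulrC.
- by rewrite probability_setT subr0.
- by rewrite divr_gt0// delta_gt0.
Qed.

(** * Optimal value, optimality and non-existence *)

Notation gamma := (gamma_star P m rho).

Lemma zeta_le_gamma c : (0 < c < 1)%R -> (zeta c)%:E <= gamma.
Proof. by move=> c01; apply: ereal_sup_ubound; exists c => //=; rewrite in_itv. Qed.

Lemma Vfun_le_gamma X : feasible P rho x X ->
  Vfun P m X <= maxe (delta^-1)%:E gamma * x%:E.
Proof.
move=> fX; have : (delta^-1)%:E <= maxe (delta^-1)%:E gamma by rewrite le_max lexx.
have : gamma <= maxe (delta^-1)%:E gamma by rewrite le_max lexx orbT.
case: (maxe _ _) => [M| |]; rewrite ?leeNy_eq//; last first.
  by move=> _ _; rewrite gt0_mulye ?leey// lte_fin.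
move=> gM; rewrite lee_fin => dM; apply: Vfun_le => // c c01.
by rewrite -lee_fin; apply: le_trans gM; exact: zeta_le_gamma.
Qed.

(** For the lower bound, the constant payoff accounts for [1 / delta] and the digital payoffs
    together for [gamma]; dividing by [x > 0] reduces the latter to a bound on each [zeta c]. *)
Lemma opt_valueE : opt_value P m rho x = maxe (delta^-1)%:E gamma * x%:E.
Proof.
apply/eqP; rewrite eq_le; apply/andP; split.
  by apply: ge_ereal_sup => _ [X fX <-]; exact: Vfun_le_gamma.
have opt_cst : (delta^-1)%:E * x%:E <= opt_value P m rho x.
  by apply: ereal_sup_ubound; exists (fun=> x / delta)%R;
    [exact: feasible_cst|exact: Vfun_cst].
have opt_digital : gamma * x%:E <= opt_value P m rho x.
  rewrite -lee_pdivlMr//; apply: ge_ereal_sup => _ [c /= + <-].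
  rewrite in_itv/= => c01; rewrite lee_pdivlMr// -EFinM -Vfun_digital//.
  by apply: ereal_sup_ubound; exists (digital_c c) => //; exact: feasible_digital.
by rewrite /Order.max; case: ifP.
Qed.

Lemma optimal_of_value X : feasible P rho x X ->
  Vfun P m X = maxe (delta^-1)%:E gamma * x%:E -> optimal P m rho x X.
Proof. by move=> fX VX; split=> // Y fY; rewrite VX; exact: Vfun_le_gamma. Qed.

(** Without attainment every [zeta c] is strictly below the finite [gamma], so [Vfun_lt] keeps the
    value of [X] strictly below the optimal one. *)
Lemma no_optimal : (delta^-1)%:E < gamma < +oo ->
  ~ (exists2 c, (0 < c < 1)%R & (zeta c)%:E = gamma) ->
  ~ exists X, optimal P m rho x X.
Proof.
move=> /andP[dg goo] gN [X [fX optX]].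
have gE : gamma = (fine gamma)%:E.
  by rewrite fineK// fin_numElt goo (lt_trans _ dg)// ltNyr.
have : Vfun P m X < (fine gamma * x)%:E.
  apply: Vfun_lt => //; first by rewrite -lte_fin -gE.
  move=> c c01; rewrite -lte_fin -gE lt_neqAle zeta_le_gamma// andbT.
  by apply/eqP => cg; apply: gN; exists c.
rewrite EFinM -gE; apply/negP; rewrite -leNgt.
have -> : gamma * x%:E = opt_value P m rho x.
  by rewrite opt_valueE /Order.max dg.
by apply: ge_ereal_sup => _ [Y fY <-]; exact: optX.
Qed.

(** * Essential infimum of the kernel and limits of digital payoffs *)

Let e : \bar R := ess_inf P (EFin \o rho).

(** Otherwise [rho] would exceed the threshold almost surely, while [cheap c] has probability
    [1 - c > 0]. *)
Lemma ess_inf_le_threshold c : (0 < c < 1)%R -> e <= (threshold c)%:E.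
Proof.
move=> c01; rewrite leNgt; apply/negP => be.
have [N [mN N0 CN]] : {ae P, forall w, ~ cheap c w}.
  apply: filterS (ess_inf_le P (EFin \o rho)) => w ew; apply/negP.
  by rewrite -ltNge -lte_fin (lt_le_trans be).
have : P (cheap c) = 0.
  apply: (subset_measure0 _ mN _ N0); first exact: measurable_cheap.
  by move=> w Cw; apply: CN => /=; apply.
by rewrite cheapE// => -[] /eqP; rewrite subr_eq0 gt_eqF//; case/andP : c01.
Qed.

Lemma ess_inf_fin : e \is a fin_num.
Proof.
have half : (0 < (2^-1 : R) < 1)%R by apply/andP; split; lra.
rewrite ge0_fin_numE; first exact: le_lt_trans (ess_inf_le_threshold half) (ltry _).
by apply/ess_infP; apply: filterS rho_gt0 => w /ltW.
Qed.

(** If [rho <= b] had probability 0, [b] would be an almost sure lower bound of [rho], hence at most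
    [e]. *)
Lemma cost_near_ess_inf (b : R) : e < b%:E -> 0 < cost [set w | (rho w <= b)%R].
Proof.
move=> eb; have mB := measurable_le_fun mrho b; apply: cost_pos => //.
rewrite lt_neqAle measure_ge0 andbT; apply/eqP => PB0.
suff : b%:E <= e by rewrite leNgt eb.
apply/ess_infP; exists [set w | (rho w <= b)%R]; split => //.
move=> w /=; rewrite lee_fin => /negP; rewrite -ltNge; exact: ltW.
Qed.

(** The [c n] are taken with [zeta (c n) > n]. Since [zeta c * phi c = m[c, 1] <= 1], the costs
    [phi (c n)] tend to 0, which pushes the thresholds down to the essential infimum. *)
Lemma digital_unbounded : gamma = +oo ->
  exists beta : nat -> R,
    (beta n)%:E @[n --> \oo] --> e /\
    (forall n, feasible P rho x (digital P rho x (beta n))) /\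
    Vfun P m (digital P rho x (beta n)) @[n --> \oo] --> +oo.
Proof.
move=> goo.
have /choice[c cP] n : exists c, (0 < c < 1)%R /\ (n%:R < zeta c)%R.
  have : n%:R%:E < gamma by rewrite goo ltry.
  move=> /ereal_sup_gt[_ [c /= + <-]]; rewrite in_itv/= lte_fin => c01 nc.
  by exists c.
have c01 n := (cP n).1; have zc n := (cP n).2.
exists (threshold \o c); split; last split.
- rewrite -(fineK ess_inf_fin); apply: cvg_EFin; first exact: nearW.
  apply/cvgrPdist_lt => eps eps0; set b := (fine e + eps)%R.
  have eb : e < b%:E by rewrite -(fineK ess_inf_fin) lte_fin ltrDl.
  have k0 := cost_near_ess_inf eb; have mB := measurable_le_fun mrho b.
  set k := fine (cost [set w | (rho w <= b)%R]).
  have kE : cost [set w | (rho w <= b)%R] = k%:E by rewrite fineK// cost_finite.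
  near=> n.
  have en : (fine e <= threshold (c n))%R.
    by rewrite -lee_fin fineK ?ess_inf_fin//; exact: ess_inf_le_threshold.
  (* A threshold at or above [b] would give [phi (c n) >= k], hence
     [zeta (c n) * phi (c n) > n * k >= 1] as soon as [n >= 1 / k]. *)
  rewrite distrC ger0_norm ?subr_ge0// ltrBlDl ltNge; apply/negP => bn.
  have kphi : (k <= phi (c n))%R.
    rewrite -lee_fin -kE phiE//; apply: le_cost => //; first exact: measurable_cheap.
    by move=> w /= /le_trans; apply.
  have : (zeta (c n) * phi (c n) <= 1)%R.
    by rewrite -lee_fin -zeta_phi//; exact: probability_le1.
  apply/negP; rewrite -ltNge; apply: (@le_lt_trans _ _ (n%:R * phi (c n)))%R.
    apply: (@le_trans _ _ (n%:R * k))%R; last by rewrite ler_wpM2l.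
    rewrite -ler_pdivrMr; last by rewrite -lte_fin -kE.
    by near: n; exact: nbhs_infty_ger.
  by rewrite ltr_pM2r ?phi_gt0.
- by move=> n; exact: feasible_digital.
- under eq_cvg do rewrite (Vfun_digital (c01 _)).
  apply/cvgeyPge => A; near=> n; rewrite lee_fin -ler_pdivrMr//.
  apply: le_trans (ltW (zc n)).
  by near: n; exact: nbhs_infty_ger.
Unshelve. all: by end_near.
Qed.

Lemma digital_cvg (c : nat -> R) : (delta^-1)%:E < gamma < +oo ->
  (forall n, (0 < c n < 1)%R) ->
  (zeta (c n))%:E @[n --> \oo] --> gamma ->
  Vfun P m (digital_c (c n)) @[n --> \oo] --> opt_value P m rho x.
Proof.
move=> /andP[dg _] c01 zg; under eq_cvg do rewrite (Vfun_digital (c01 _)) EFinM.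
by rewrite opt_valueE /Order.max dg; exact: cvgeZr.
Qed.

End portfolio.


Theorem theorem1 (R : realType) (d : measure_display) (T : measurableType d)
  (P : probability T R) (rho : T -> R) (m : probability R R) (x : R) :
  measurable_fun setT rho ->
  {ae P, forall w, (0 < rho w)%R} ->
  P.-integrable setT (EFin \o rho) ->
  continuous (fun t => fine (cdfF P rho t)) ->
  m `[0%R, 1%R]%classic = 1 ->
  (0 < x)%R ->
  (* optimal value *)
  opt_value P m rho x =
    maxe ((fine (\int[P]_w (rho w)%:E))^-1)%:E (gamma_star P m rho) * x%:E
  (* (i) *)
  /\ (gamma_star P m rho = +oo ->
      exists beta : nat -> R,
        (beta n)%:E @[n --> \oo] --> ess_inf P (EFin \o rho) /\
        (forall n, feasible P rho x (digital P rho x (beta n))) /\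
        Vfun P m (digital P rho x (beta n)) @[n --> \oo] --> +oo)
  (* (ii) *)
  /\ (gamma_star P m rho <= ((fine (\int[P]_w (rho w)%:E))^-1)%:E ->
      optimal P m rho x (fun _ => x / fine (\int[P]_w (rho w)%:E))%R)
  (* (iii) *)
  /\ (((fine (\int[P]_w (rho w)%:E))^-1)%:E < gamma_star P m rho < +oo ->
      forall cs : R, cs \in `]0%R, 1%R[ ->
      (zeta P m rho cs)%:E = gamma_star P m rho ->
      optimal P m rho x (digital P rho x (fine (quantile P rho (1 - cs)%R))))
  (* (iv) *)
  /\ (((fine (\int[P]_w (rho w)%:E))^-1)%:E < gamma_star P m rho < +oo ->
      ~ (exists2 cs : R, cs \in `]0%R, 1%R[ &
           (zeta P m rho cs)%:E = gamma_star P m rho) ->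
      (~ exists X : T -> R, optimal P m rho x X) /\
      forall c : nat -> R, (forall n, c n \in `]0%R, 1%R[) ->
        (zeta P m rho (c n))%:E @[n --> \oo] --> gamma_star P m rho ->
        (forall n, feasible P rho x
                     (digital P rho x (fine (quantile P rho (1 - c n)%R)))) /\
        Vfun P m (digital P rho x (fine (quantile P rho (1 - c n)%R)))
          @[n --> \oo] --> opt_value P m rho x).
Proof.
move=> mrho rho_gt0 irho crho m01 x_gt0.
have itvE c : (c \in `]0%R, 1%R[) = (0 < c < 1)%R by rewrite in_itv.
have optE : opt_value P m rho x =
    maxe ((fine (\int[P]_w (rho w)%:E))^-1)%:E (gamma_star P m rho) * x%:E.
  exact: opt_valueE.
split; [exact: optE|split; [|split; [|split]]].
- exact: digital_unbounded.
- move=> gd; apply: optimal_of_value => //; first exact: feasible_cst.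
  by rewrite Vfun_cst// EFinM max_l.
- move=> /andP[dg _] c; rewrite itvE => c01 cg.
  apply: optimal_of_value => //; first exact: feasible_digital.
  by rewrite Vfun_digital// EFinM cg max_r// ltW.
- move=> dgoo gN; split.
    exact: no_optimal.
  move=> c cI zg; have c01 n : (0 < c n < 1)%R by rewrite -itvE.
  by split=> [n|]; [exact: feasible_digital|exact: digital_cvg].
Qed.
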